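(* Let $\nu\in\mathcal{P}$, let $\theta>0$ be a constant, let $K$ be a kernel on $(S,\mathcal{B})$, and let $X=(X_1,X_2,\ldots)$ be a sequence of $S$-valued random variables such that $X_1\sim\nu$ and, for all $n\ge 1$, $$P\bigl(X_{n+1}\in\cdot\mid\mathcal{F}_n\bigr)=\frac{\theta\,\nu(\cdot)+\sum_{i=1}^nK(X_i)(\cdot)}{n+\theta}\quad\text{a.s.}$$ Then $X$ is exchangeable if and only if $$\int_AK(y)(B)\,\nu(dy)=\int_BK(y)(A)\,\nu(dy)$$ and $$\int_AK(y)(B)\,K(x)(dy)=\int_BK(y)(A)\,K(x)(dy)$$ for all $A,B\in\mathcal{B}$ and $\nu$-almost all $x\in S$. In particular, $X$ is exchangeable whenever $K$ is a regular conditional distribution for $\nu$ given $\mathcal{G}$, for some sub-$\sigma$-field $\mathcal{G}\subset\mathcal{B}$.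
   Context: $S$ is a Borel subset of a Polish space and $\mathcal{B}$ is its Borel $\sigma$-field. All random elements are defined on a probability space $(\Omega,\mathcal{A},P)$, and $\mathcal{F}_n=\sigma(X_1,\ldots,X_n)$. $\mathcal{P}$ is the set of all probability measures on $\mathcal{B}$, and $\mathcal{C}$ is the $\sigma$-field on $\mathcal{P}$ generated by the maps $p\mapsto p(A)$, $A\in\mathcal{B}$. A kernel on $(S,\mathcal{B})$ is a measurable map $K:(S,\mathcal{B})\to(\mathcal{P},\mathcal{C})$; $K(x)(A)$ is the value of the probability measure $K(x)$ at $A$. $K$ is a regular conditional distribution for $\nu$ given a sub-$\sigma$-field $\mathcal{G}\subset\mathcal{B}$ if $K(x)\in\mathcal{P}$ for each $x\in S$, $x\mapsto K(x)(A)$ is $\mathcal{G}$-measurable for each $A\in\mathcal{B}$, and $\nu(A\cap G)=\int_GK(x)(A)\,\nu(dx)$ for all $A\in\mathcal{B}$, $G\in\mathcal{G}$. The sequence $X$ is exchangeable if for all $n\ge 2$ and all permutations $(j_1,\ldots,j_n)$ of $(1,\ldots,n)$, $(X_{j_1},\ldots,X_{j_n})$ has the same distribution as $(X_1,\ldots,X_n)$. *)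

(* Defs.v *)
From HB Require Import structures.
From mathcomp Require Import all_boot all_order all_algebra all_fingroup.
From mathcomp Require Import all_classical all_reals all_analysis.
From mathcomp Require Import measurable_realfun.

Set Implicit Arguments.
Unset Strict Implicit.
Unset Printing Implicit Defensive.

Import Order.TTheory GRing.Theory Num.Theory.

Local Open Scope classical_set_scope.
Local Open Scope ring_scope.

Definition separable (T : topologicalType) : Prop :=
  exists2 D : set T, countable D & dense D.

Definition completely_metrizable (R : realType) (T : topologicalType) : Prop :=
  exists dist : T -> T -> R,
    [/\ forall x y, dist x y = 0 <-> x = y,
        forall x y, dist x y = dist y x,
        forall x y z, dist x z <= dist x y + dist y z,
        forall x, nbhs x =
          filter_from [set e : R | 0 < e] (fun e => [set y | dist x y < e]) &
        forall u : nat -> T,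
          (forall e : R, 0 < e -> exists N : nat,
             forall m n : nat, (N <= m)%N -> (N <= n)%N -> dist (u m) (u n) < e) ->
          exists l : T, u @ \oo --> l].

Definition polish (R : realType) (T : topologicalType) : Prop :=
  separable T /\ completely_metrizable R T.

Definition borel (T : topologicalType) : set (set T) := <<s @open T >>.

(* [A] as a type. Measurable types are pointed, whence the nonemptiness proof;
   it costs no generality on a space that carries a probability measure. *)
Definition pointed_subset (T : topologicalType) (A : set T) (A0 : A !=set0)
  : pointedType :=
  HB.pack (set_type A) (isPointed.Build (set_type A)
    (exist _ (projT1 (cid A0)) (mem_set (projT2 (cid A0))))).

Definition subspace_open (T : topologicalType) (A : set T) (A0 : A !=set0)
  : set (set (pointed_subset A0)) := @open (set_type A).
Arguments subspace_open {T A} A0.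

Definition borel_subspace (T : topologicalType) (A : set T) (A0 : A !=set0)
  : measurableType (subspace_open A0).-sigma :=
  g_sigma_algebraType (subspace_open A0).

Definition measurable_wrt (T : Type) (d : measure_display)
    (U : measurableType d) (F : set (set T)) (f : T -> U) : Prop :=
  forall B : set U, measurable B -> F (f @^-1` B).

(* [Z] is a version of the conditional probability of [E] given [F] *)
Definition is_cond_prob (R : realType) (d : measure_display)
    (Omega : measurableType d) (P : probability Omega R)
    (F : set (set Omega)) (E : set Omega) (Z : Omega -> \bar R) : Prop :=
  measurable_wrt F Z /\
  forall G : set Omega, F G -> (\int[P]_(w in G) Z w = P (E `&` G))%E.

(* Sequences are indexed from 0: [X i] is the (i+1)-st variable, and the
   sigma-field at [n] is generated by the first [n] variables. *)
Definition natural_filtration (d d' : measure_display)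
    (Omega : measurableType d) (S : measurableType d') (X : nat -> Omega -> S)
    (n : nat) : set (set Omega) :=
  g_sigma_preimage (fun i : 'I_n => X i).

Definition exchangeable (R : realType) (d d' : measure_display)
    (Omega : measurableType d) (S : measurableType d')
    (P : probability Omega R) (X : nat -> Omega -> S) : Prop :=
  forall (n : nat), (2 <= n)%N -> forall (s : {perm 'I_n}) (B : set (n.-tuple S)),
    measurable B ->
    pushforward P (fun w => [tuple X (s i) w | i < n]) B =
    pushforward P (fun w => [tuple X i w | i < n]) B.

Definition predictive (R : realType) (d d' : measure_display)
    (Omega : measurableType d) (S : measurableType d')
    (nu : probability S R) (theta : R) (K : {mfun S >-> pprobability S R})
    (X : nat -> Omega -> S) (n : nat) (A : set S) (w : Omega) : \bar R :=
  ((theta%:E * nu A + \sum_(i < n) (K (X i w) : probability S R) A)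
     * ((n%:R + theta)^-1)%:E)%E.

Definition regular_cond_distr (R : realType) (d : measure_display)
    (S : measurableType d) (nu : probability S R) (G : set (set S))
    (K : S -> probability S R) : Prop :=
  (forall A : set S, measurable A -> measurable_wrt G (fun x => K x A)) /\
  (forall A B : set S, measurable A -> G B ->
     nu (A `&` B) = (\int[nu]_(x in B) K x A)%E).

(* Main.v *)
(* Iterating the predictive rule twice gives, for V measurable with respect to the
   first n variables and nonnegative g, h,
     (n+1+theta)(n+theta) E[V g(X_{n+1}) h(X_{n+2})] = sym + asym,
   where sym is symmetric in (g, h) and, with Kh(x) the integral of h against K(x),
     asym = theta nu(g Kh) E[V] + sum_(i <= n) E[V K(g Kh)(X_i)].
   So exchanging two consecutive variables preserves the law iff asym is symmetric
   in (g, h). For n = 0 this is the first reversibility condition, and for n = 1 the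
   second one. Conversely, reversibility makes asym symmetric for all n once the X_i
   are known to have law nu, and together with the exchangeability of the first n+1
   variables the exchange of the last two gives that of the first n+2. *)
Require Import Defs.
From HB Require Import structures.
From mathcomp Require Import all_boot all_order all_algebra all_fingroup.
From mathcomp Require Import all_classical all_reals all_analysis.
From mathcomp Require Import measurable_realfun.

Set Implicit Arguments.
Unset Strict Implicit.
Unset Printing Implicit Defensive.

Import Order.TTheory GRing.Theory Num.Theory.

Local Open Scope classical_set_scope.
Local Open Scope ring_scope.

(** * Positive operators on nonnegative measurable functions *)

Section NonnegMeasurable.
Local Open Scope ereal_scope.
Context {R : realType} {d : measure_display} {T : measurableType d}.

Definition nnm (f : T -> \bar R) : Prop :=
  measurable_fun [set: T] f /\ forall x, 0 <= f x.

Lemma nnm_indic (A : set T) : measurable A -> nnm (fun x => (\1_A x)%:E).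
Proof.
move=> mA; split=> [|x]; last by rewrite lee_fin.
exact/measurable_EFinP/measurable_indic.
Qed.

Lemma nnmD (f g : T -> \bar R) : nnm f -> nnm g -> nnm (fun x => f x + g x).
Proof.
move=> [mf f0] [mg g0]; split=> [|x]; first exact: emeasurable_funD.
exact: adde_ge0.
Qed.

Lemma nnmM (f g : T -> \bar R) : nnm f -> nnm g -> nnm (fun x => f x * g x).
Proof.
move=> [mf f0] [mg g0]; split=> [|x]; first exact: emeasurable_funM.
exact: mule_ge0.
Qed.

Lemma nnm_cst (c : \bar R) : 0 <= c -> nnm (fun=> c).
Proof. by move=> c0; split. Qed.

Lemma nnm_sum (I : Type) (s : seq I) (f : I -> T -> \bar R) :
  (forall i, nnm (f i)) -> nnm (fun x => \sum_(i <- s) f i x).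
Proof.
move=> nf; split=> [|x]; first by apply: emeasurable_sum => i; case: (nf i).
by apply: sume_ge0 => i _; case: (nf i).
Qed.

Lemma nnm_prod (I : Type) (s : seq I) (f : I -> T -> \bar R) :
  (forall i, nnm (f i)) -> nnm (fun x => \prod_(i <- s) f i x).
Proof.
move=> nf; elim: s => [|i s IHs].
  under eq_fun do rewrite big_nil; exact: nnm_cst.
by under eq_fun do rewrite big_cons; exact: nnmM.
Qed.

End NonnegMeasurable.

Lemma nnm_comp {R : realType} {d1 d2 : measure_display} {T1 : measurableType d1}
    {T2 : measurableType d2} (f : T2 -> \bar R) (X : T1 -> T2) :
  measurable_fun setT X -> nnm f -> nnm (f \o X).
Proof. by move=> mX [mf f0]; split=> [|x]; [exact: measurableT_comp|exact: f0]. Qed.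

Section PositiveOperator.
Local Open Scope ereal_scope.
Context {R : realType}.

(* Both integrals and f |-> (x |-> \int[k x]_y f y) are such operators, and the class
   is closed under composition; an identity between two of them need only be checked
   on indicators (posop_ext). *)
Record posop {d1 d2 : measure_display} {T1 : measurableType d1}
    {T2 : measurableType d2} (L : (T1 -> \bar R) -> T2 -> \bar R) : Prop := Posop {
  posop_nnm : forall f, nnm f -> nnm (L f);
  posop_le : forall f g, nnm f -> nnm g -> (forall x, f x <= g x) ->
    forall y, L f y <= L g y;
  posopD : forall f g, nnm f -> nnm g ->
    forall y, L (fun x => f x + g x) y = L f y + L g y;
  posopZ : forall (c : R) f, (0 <= c)%R -> nnm f ->
    forall y, L (fun x => c%:E * f x) y = c%:E * L f y;
  posop_cvg : forall (u : nat -> T1 -> \bar R) f, (forall n, nnm (u n)) -> nnm f ->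
    (forall x, {homo u ^~ x : m n / (m <= n)%N >-> m <= n}) ->
    (forall x, u ^~ x @ \oo --> f x) ->
    forall y, (fun n => L (u n) y) @ \oo --> L f y }.

Section Theory.
Context {d1 d2 d3 : measure_display} {T1 : measurableType d1}
  {T2 : measurableType d2} {T3 : measurableType d3}.

Lemma posop_comp (L : (T2 -> \bar R) -> T3 -> \bar R)
    (M : (T1 -> \bar R) -> T2 -> \bar R) :
  posop L -> posop M -> posop (fun f => L (M f)).
Proof.
move=> pL pM; have nM f : nnm f -> nnm (M f) by exact: (posop_nnm pM).
split.
- by move=> f nf; exact/(posop_nnm pL)/nM.
- by move=> f g nf ng fg; apply: (posop_le pL); [exact: nM..|exact: (posop_le pM)].
- move=> f g nf ng y; rewrite -(posopD pL); [|exact: nM..].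
  by congr (L _ y); apply/funext => x; rewrite (posopD pM).
- move=> c f c0 nf y; rewrite -(posopZ pL)//; last exact: nM.
  by congr (L _ y); apply/funext => x; rewrite (posopZ pM).
- move=> u f nu nf ndu uf; apply: (posop_cvg pL) => [n||x m n mn|x].
  + exact: nM.
  + exact: nM.
  + by apply: (posop_le pM) => // z; exact: ndu.
  + exact: (posop_cvg pM).
Qed.

Lemma posopDop (L M : (T1 -> \bar R) -> T2 -> \bar R) :
  posop L -> posop M -> posop (fun f y => L f y + M f y).
Proof.
move=> pL pM; split.
- by move=> f nf; apply: nnmD; [exact: (posop_nnm pL)|exact: (posop_nnm pM)].
- by move=> f g nf ng fg y; apply: leeD; [exact: (posop_le pL)|exact: (posop_le pM)].
- by move=> f g nf ng y; rewrite (posopD pL)// (posopD pM)// addeACA.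
- move=> c f c0 nf y; rewrite (posopZ pL)// (posopZ pM)// ge0_muleDr//.
    by case: (posop_nnm pL nf).
  by case: (posop_nnm pM nf).
- move=> u f nu nf ndu uf y; apply: cvgeD; last 2 first.
  + exact: (posop_cvg pL).
  + exact: (posop_cvg pM).
  + by apply: ge0_adde_def; rewrite inE;
      [case: (posop_nnm pL nf)|case: (posop_nnm pM nf)].
Qed.

Lemma posop_sum (I : Type) (s : seq I) (L : I -> (T1 -> \bar R) -> T2 -> \bar R) :
  (forall i, posop (L i)) -> posop (fun f y => \sum_(i <- s) L i f y).
Proof.
move=> pL; elim: s => [|i s IHs].
  rewrite (_ : (fun f y => _) = fun _ _ => 0); last first.
    by apply/funext => f; apply/funext => y; rewrite big_nil.
  split.
  - by move=> f _; exact: nnm_cst.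
  - by move=> *.
  - by move=> *; rewrite adde0.
  - by move=> *; rewrite mule0.
  - by move=> *; exact: cvg_cst.
rewrite (_ : (fun f y => _) = fun f y => L i f y + \sum_(j <- s) L j f y); last first.
  by apply/funext => f; apply/funext => y; rewrite big_cons.
exact: posopDop.
Qed.

Lemma posop_precomp (X : T2 -> T1) : measurable_fun setT X ->
  posop (fun f : T1 -> \bar R => f \o X).
Proof.
by move=> mX; split=> *; try exact: nnm_comp; rewrite /comp /=; auto.
Qed.

(** Only the factor [+oo] needs an argument. Either [l] is 0 and all [u n] vanish, or some [u N] is
    positive and, by monotonicity, the products are [+oo] from [N] on. *)
Lemma cvge_mull_nd (c l : \bar R) (u : nat -> \bar R) :
  0 <= c -> (forall n, 0 <= u n) -> {homo u : m n / (m <= n)%N >-> m <= n} ->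
  u @ \oo --> l -> (fun n => c * u n) @ \oo --> c * l.
Proof.
move=> c0 u0 ndu ul; case: c c0 => [c _|_|//]; first exact: cvgeZl.
have ul_le n : u n <= l.
  have /cvg_lim <- // := ul; rewrite (cvg_lim _ (ereal_nondecreasing_cvgn ndu))//.
  by apply: ereal_sup_ubound; exists n.
have : 0 <= l by exact: le_trans (u0 0%N) (ul_le 0%N).
rewrite le_eqVlt => /predU1P[l0|l_gt0].
  have -> : u = cst 0.
    by apply/funext => n; apply/eqP; rewrite eq_le u0 l0 ul_le.
  by rewrite -l0 mule0; exact: cvg_cst.
have [N uN] : exists N, 0 < u N.
  apply: contrapT => /forallNP uN0; move: l_gt0.
  rewrite -(cvg_lim _ ul)// ltNge => /negP; apply; apply: lime_le.
    by apply/cvg_ex; exists l.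
  by apply: nearW => n; rewrite leNgt; exact/negP/uN0.
apply: cvg_near_cst; exists N => // n /= Nn.
by rewrite !gt0_mulye// (lt_le_trans uN)// ndu.
Qed.

Lemma posop_mul (h : T1 -> \bar R) : nnm h -> posop (fun f x => h x * f x).
Proof.
move=> nh; split.
- by move=> f nf; exact: nnmM.
- by move=> f g nf ng fg y; apply: lee_wpmul2l => //; case: nh.
- by move=> f g [_ f0] [_ g0] y; rewrite ge0_muleDr.
- by move=> c f c0 nf y; rewrite muleCA.
- move=> u f nu nf ndu uf y; apply: cvge_mull_nd => //; first by case: nh.
  by move=> n; case: (nu n).
Qed.

(** The value is a constant function on an arbitrary second space, so that scalar functionals take
    part in compositions; the limit clause is monotone convergence. *)
Lemma posop_integral (mu : {measure set T1 -> \bar R}) :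
  posop (fun f (_ : T2) => \int[mu]_x f x).
Proof.
split.
- by move=> f [_ f0]; apply: nnm_cst; exact: integral_ge0.
- by move=> f g [mf f0] [mg g0] fg y; exact: ge0_le_integral.
- by move=> f g [mf f0] [mg g0] y; rewrite ge0_integralD.
- by move=> c f c0 [mf f0] y; rewrite ge0_integralZl_EFin.
- move=> u f nu [mf f0] ndu uf y.
  rewrite (_ : f = fun x => limn (u ^~ x)); last first.
    by apply/funext => x; apply/esym/cvg_lim => //; exact: uf.
  apply: cvg_monotone_convergence => //.
  - by move=> n; case: (nu n).
  - by move=> n x _; case: (nu n).
Qed.

Lemma posop_kernel (k : T2 -> {measure set T1 -> \bar R}) :
  (forall A, measurable A -> measurable_fun setT (k ^~ A)) ->
  posop (fun f x => \int[k x]_y f y).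
Proof.
move=> mk; split.
- move=> f [mf f0]; split=> [|x]; last exact: integral_ge0.
  exact: measurable_fun_integral_kernel.
- by move=> f g nf ng fg y; exact: (posop_le (posop_integral (k y))).
- by move=> f g nf ng y; exact: (posopD (posop_integral (k y))).
- by move=> c f c0 nf y; exact: (posopZ (posop_integral (k y))).
- by move=> u f nu nf ndu uf y; exact: (posop_cvg (posop_integral (k y))).
Qed.

Import HBNNSimple.

(** A nonnegative measurable function is an increasing limit of simple functions. Additivity and
    homogeneity settle the simple ones, and [posop_cvg] passes to the limit. *)
Lemma posop_ext (L M : (T1 -> \bar R) -> T2 -> \bar R) : posop L -> posop M ->
  (forall A y, measurable A ->
     L (fun x => (\1_A x)%:E) y = M (fun x => (\1_A x)%:E) y) ->
  forall f, nnm f -> L f = M f.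
Proof.
move=> pL pM LM f nf; have [mf f0] := nf.
apply/funext => y.
have posop_simple N (pN : posop N) (n : nat) (c : 'I_n -> R) (A : 'I_n -> set T1) :
    (forall i, 0 <= c i)%R -> (forall i, measurable (A i)) ->
    N (fun x => \sum_(i < n) (c i)%:E * (\1_(A i) x)%:E) y =
    \sum_(i < n) (c i)%:E * N (fun x => (\1_(A i) x)%:E) y.
  move=> c0 mA.
  have nterm i : nnm (fun x => (c i)%:E * (\1_(A i) x)%:E).
    by apply: nnmM; [apply: nnm_cst; rewrite lee_fin|exact: nnm_indic].
  elim: (index_enum 'I_n) => [|i s IHs].
    rewrite big_nil; under eq_fun do rewrite big_nil.
    (* Homogeneity with the factor 0 shows that the operator maps 0 to 0, as the empty sum
       requires. *)
    have := posopZ pN (lexx 0%R) (nnm_cst (lexx 0)) y.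
    by rewrite !mul0e.
  rewrite big_cons; under eq_fun do rewrite big_cons.
  rewrite (posopD pN)//; last exact: nnm_sum.
  by rewrite IHs (posopZ pN)//; exact: nnm_indic.
pose u n x := (nnsfun_approx measurableT mf n x)%:E.
have nu n : nnm (u n).
  by split=> [|x]; [exact/measurable_EFinP/measurable_funP|rewrite lee_fin].
have ndu x : {homo u ^~ x : m n / (m <= n)%N >-> m <= n}.
  by move=> m n mn; rewrite lee_fin; exact/lefP/nd_nnsfun_approx.
have uf x : u ^~ x @ \oo --> f x by exact: cvg_nnsfun_approx.
have LMu n : L (u n) y = M (u n) y.
  set g := nnsfun_approx measurableT mf n.
  pose s : seq R := finmap.enum_fset (fset_set (range g)).
  have s_ge0 (i : 'I_(size s)) : (0 <= nth 0%R s i)%R.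
    have : nth 0%R s i \in s by exact: mem_nth.
    by rewrite in_fset_set// inE /= => -[x _ <-].
  (* The approximating function is the sum of its finitely many values times the indicators of their
     fibres. *)
  have -> : u n = fun x => \sum_(i < size s)
      (nth 0%R s i)%:E * (\1_(g @^-1` [set nth 0%R s i]) x)%:E.
    apply/funext => x; rewrite /u -/g fimfunEord -sumEFin.
    by apply: eq_bigr => i _; rewrite EFinM.
  by rewrite !posop_simple//; apply: eq_bigr => i _; rewrite LM.
have cL : (fun n => L (u n) y) @ \oo --> L f y by exact: (posop_cvg pL).
have cM : (fun n => M (u n) y) @ \oo --> M f y by exact: (posop_cvg pM).
rewrite -(cvg_lim _ cL)// -(cvg_lim _ cM)//.
by under eq_fun do rewrite LMu.
Qed.

End Theory.
End PositiveOperator.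

(** * Sub-sigma-fields *)

Section SubSigmaField.
Local Open Scope ereal_scope.
Context {R : realType} {d : measure_display} {T : measurableType d}.
Implicit Types mu : {measure set T -> \bar R}.

Lemma integral_mulindic mu (E : set T) (f : T -> \bar R) : measurable E ->
  \int[mu]_(x in E) f x = \int[mu]_x (f x * (\1_E x)%:E).
Proof.
move=> mE; rewrite integral_mkcond; apply: eq_integral => x _.
by rewrite patchE indicE; case: (x \in E); rewrite ?mule1 ?mule0.
Qed.

Lemma integral_mul_indic mu (E : set T) (f : T -> \bar R) : measurable E ->
  \int[mu]_x ((\1_E x)%:E * f x) = \int[mu]_(x in E) f x.
Proof.
by move=> mE; rewrite (integral_mulindic _ _ mE); under eq_integral do rewrite muleC.
Qed.

Lemma nnm_sub_sigma (G : set (set T)) (f : g_sigma_algebraType G -> \bar R) :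
  G `<=` measurable -> nnm f -> nnm (f : T -> \bar R).
Proof.
move=> Gm [mf f0]; split=> // _ B mB; have := mf measurableT _ mB.
by apply: smallest_sub; [exact: sigma_algebra_measurable|exact: Gm].
Qed.

(** Both sides are positive operators in [f] on the coarser measurable space. It suffices to take
    indicators of events of the generated sigma-field, and for these the claim is the hypothesis. *)
Lemma integral_mul_sub_sigma mu (G : set (set T)) (u v : T -> \bar R) :
  G `<=` measurable -> nnm u -> nnm v ->
  (forall E, <<s G >> E -> \int[mu]_(x in E) u x = \int[mu]_(x in E) v x) ->
  forall f : g_sigma_algebraType G -> \bar R, nnm f ->
    \int[mu]_x (f x * u x) = \int[mu]_x (f x * v x).
Proof.
move=> Gm nu nv uv f nf.
have mG E : <<s G >> E -> measurable E.
  by apply: smallest_sub; [exact: sigma_algebra_measurable|exact: Gm].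
(* The identity from the finer to the coarser sigma-field is measurable, so composing with it turns
   [f] into a function on [T]. *)
have mid : measurable_fun setT (id : T -> g_sigma_algebraType G).
  by move=> _ B mB; rewrite setTI; exact: mG.
pose L h (f : g_sigma_algebraType G -> \bar R) (_ : unit) :=
  \int[mu]_x (h x * (f \o (id : T -> g_sigma_algebraType G)) x).
have pL h : nnm h -> posop (L h).
  move=> nh; apply: (posop_comp (posop_integral mu)).
  exact: (posop_comp (posop_mul nh) (posop_precomp mid)).
have := posop_ext (pL _ nu) (pL _ nv).
move=> /(_ _ f nf) /(congr1 (fun g => g tt)).
rewrite /L /=; under eq_integral do rewrite muleC.
under [in RHS]eq_integral do rewrite muleC.
apply=> E _ mE; rewrite -!(integral_mulindic _ _ (mG _ mE)); exact: uv.
Qed.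

End SubSigmaField.

(** * Integration against the kernel *)

Section Kernel.
Local Open Scope ereal_scope.
Context {R : realType} {d : measure_display} {S : measurableType d}.
Variable K : {mfun S >-> pprobability S R}.

Definition kint (f : S -> \bar R) (x : S) : \bar R :=
  \int[(K x : probability S R)]_y f y.

Lemma measurable_kernel_eval (A : set S) : measurable A ->
  measurable_fun setT (fun x => (K x : probability S R) A).
Proof. exact: (measurable_kernel (kprobability (measurable_funP K))). Qed.

Lemma posop_kint : posop kint.
Proof.
exact: (@posop_kernel _ _ _ _ _ (fun x => (K x : probability S R))
  measurable_kernel_eval).
Qed.

Lemma nnm_kint f : nnm f -> nnm (kint f).
Proof. exact: (posop_nnm posop_kint). Qed.

Lemma kint_indic (A : set S) (x : S) : measurable A ->
  kint (fun y => (\1_A y)%:E) x = (K x : probability S R) A.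
Proof. by move=> mA; rewrite /kint integral_indic// setIT. Qed.

(** Symmetry passes from sets to functions one argument at a time: first [g] with [h] an indicator,
    then [h] with [g] fixed. The one-point space [unit] makes a scalar functional a [posop]. *)
Lemma reversible_ext (L : (S -> \bar R) -> unit -> \bar R) : posop L ->
  (forall A B, measurable A -> measurable B ->
    L (fun x => (\1_A x)%:E * (K x : probability S R) B) tt =
    L (fun x => (\1_B x)%:E * (K x : probability S R) A) tt) ->
  forall g h, nnm g -> nnm h ->
    L (fun x => g x * kint h x) tt = L (fun x => h x * kint g x) tt.
Proof.
move=> pL LAB.
have pLl h : nnm h -> posop (fun g => L (fun x => h x * g x)).
  by move=> nh; apply: (posop_comp pL); exact: posop_mul.
have pLk h : nnm h -> posop (fun g => L (fun x => h x * kint g x)).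
  by move=> nh; apply: (posop_comp (pLl _ nh)); exact: posop_kint.
have mulLC f g : L (fun x => f x * g x) = L (fun x => g x * f x).
  by congr L; apply/funext => x; rewrite muleC.
have LgB g B : nnm g -> measurable B ->
    L (fun x => g x * kint (fun y => (\1_B y)%:E) x) tt =
    L (fun x => (\1_B x)%:E * kint g x) tt.
  move=> ng mB; rewrite mulLC.
  have nB := nnm_kint (nnm_indic (R := R) mB).
  have := posop_ext (pLl _ nB) (pLk _ (nnm_indic mB)).
  move=> /(_ _ g ng) -> // A [] mA; rewrite mulLC.
  under eq_fun do rewrite kint_indic//.
  by under [in RHS]eq_fun do rewrite kint_indic//; exact: LAB.
move=> g h ng nh; rewrite [in RHS]mulLC.
have := posop_ext (pLk _ ng) (pLl _ (nnm_kint ng)).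
move=> /(_ _ h nh) -> // B [] mB; rewrite LgB//.
by rewrite mulLC.
Qed.

End Kernel.

(** * Distributivity and cancellation in the extended reals *)

Section ErealArithmetic.
Local Open Scope ereal_scope.
Context {R : realType}.
Implicit Types a b c e x y : \bar R.

Lemma sume_distr4 (I : Type) (s : seq I) a b c e (J : I -> \bar R) :
  0 <= a -> 0 <= b -> 0 <= e -> (forall i, 0 <= J i) ->
  (a * b + (\sum_(i <- s) J i + e)) * c =
  a * (b * c) + \sum_(i <- s) J i * c + e * c.
Proof.
move=> a0 b0 e0 J0; have sJ0 : 0 <= \sum_(i <- s) J i by exact: sume_ge0.
rewrite ge0_muleDl ?mule_ge0 ?adde_ge0// ge0_muleDl// -muleA addeA.
by rewrite ge0_sume_distrl.
Qed.

Lemma mule_cancel (c : R) x y : (0 < c)%R -> x * c%:E = y * c%:E -> x = y.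
Proof.
move=> c0 /(congr1 (fun z => z * (c^-1)%:E)).
by rewrite -!muleA -EFinM divff ?gt_eqF// !mule1.
Qed.

Lemma adde_cancel x y z : 0 <= x -> x < +oo -> x + y = x + z -> y = z.
Proof.
move=> x0 xoo /(congr1 (fun t => t - x)).
have xfin : x \is a fin_num by rewrite ge0_fin_numE.
by rewrite !(addeC x) !addeK.
Qed.

End ErealArithmetic.

Lemma integral_le1 {R : realType} {d : measure_display} {T : measurableType d}
    (mu : probability T R) (f : T -> \bar R) :
  nnm f -> (forall x, f x <= 1)%E -> (\int[mu]_x f x <= 1)%E.
Proof.
move=> [mf f0] f1; apply: (@le_trans _ _ (\int[mu]_x 1)%E).
  exact: ge0_le_integral.
by rewrite integral_cst// mul1e; exact: probability_le1.
Qed.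

(** * Sequences with kernel-driven predictive distributions *)

Section Predictive.
Local Open Scope ereal_scope.
Context {R : realType} {d d' : measure_display} {Omega : measurableType d}
  {S : measurableType d'}.
Variables (P : probability Omega R) (nu : probability S R) (theta : R).
Hypothesis theta_gt0 : (0 < theta)%R.
Variables (K : {mfun S >-> pprobability S R}) (X : nat -> {RV P >-> S}).
Hypothesis X_init : forall A : set S, measurable A ->
  distribution P (X 0%N) A = nu A.
Hypothesis X_pred : forall n : nat, (1 <= n)%N ->
  forall A : set S, measurable A ->
  exists2 Z : Omega -> \bar R,
    is_cond_prob P (natural_filtration X n) (X n @^-1` A) Z &
    {ae P, forall w, Z w = predictive nu theta K X n A w}.

(** These are the generators of [natural_filtration X n]; [g_sigma_algebraType] takes generators,
    and adaptedness is measurability on that type. *)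
Definition past_events (n : nat) : set (set Omega) :=
  \big[setU/set0]_(i < n) preimage_set_system setT (X i) measurable.

Definition adapted (n : nat) (V : Omega -> \bar R) : Prop :=
  nnm (V : g_sigma_algebraType (past_events n) -> \bar R).

Lemma past_events_measurable n : past_events n `<=` measurable.
Proof.
rewrite /past_events; elim/big_ind: _ => [//|A B Am Bm|i _].
  by move=> E [/Am|/Bm].
by move=> _ [B mB <-]; exact: measurable_funP.
Qed.

Lemma adapted_nnm n V : adapted n V -> nnm V.
Proof. by apply: nnm_sub_sigma; exact: past_events_measurable. Qed.

Lemma adaptedM n V W : adapted n V -> adapted n W -> adapted n (fun w => V w * W w).
Proof. exact: nnmM. Qed.

Lemma adapted_X n i g : (i < n)%N -> nnm g -> adapted n (fun w => g (X i w)).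
Proof.
move=> i_n ng; apply: (@nnm_comp _ _ _ _ _ g (X i : g_sigma_algebraType _ -> S)) => //.
move=> _ B mB; apply: sub_sigma_algebra; rewrite /past_events.
by rewrite (bigD1 (Ordinal i_n))//=; left; exists B.
Qed.

Lemma adapted_le m n V : (m <= n)%N -> adapted m V -> adapted n V.
Proof.
move=> mn [mV V0]; split=> // _ B mB; have := mV measurableT B mB.
apply: sub_sigma_algebra2; rewrite /past_events.
rewrite -(big_mkord xpredT (fun i => preimage_set_system setT (X i) measurable)).
rewrite -[X in _ `<=` X](big_mkord xpredT
  (fun i => preimage_set_system setT (X i) measurable)).
by rewrite (big_cat_nat (leq0n m) mn)//=; exact: subsetUl.
Qed.

(** This is the integral of [h] against the predictive distribution, spelled out so that it is
    visibly a positive operator in [h]. *)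
Definition pred_mean (n : nat) (h : S -> \bar R) (w : Omega) : \bar R :=
  (theta%:E * (\int[nu]_x h x) + \sum_(i < n) kint K h (X i w))
    * ((n%:R + theta)^-1)%:E.

Lemma posop_pred_mean n : posop (pred_mean n).
Proof.
have c0 : 0 <= ((n%:R + theta)^-1)%:E :> \bar R.
  by rewrite lee_fin invr_ge0 addr_ge0// ltW.
rewrite (_ : pred_mean n = fun h w => ((n%:R + theta)^-1)%:E *
    (theta%:E * (\int[nu]_x h x) + \sum_(i < n) kint K h (X i w))); last first.
  by apply/funext => h; apply/funext => w; rewrite muleC.
apply: (posop_comp (posop_mul (nnm_cst c0))).
apply: posopDop.
  apply: (posop_comp (posop_mul _) (posop_integral nu)).
  by apply: nnm_cst; rewrite lee_fin ltW.
have mX i : measurable_fun setT (X i) by [].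
by apply: posop_sum => i; exact: (posop_comp (posop_precomp (mX i)) (posop_kint K)).
Qed.

Lemma pred_mean_indic n A w : measurable A ->
  pred_mean n (fun x => (\1_A x)%:E) w = predictive nu theta K X n A w.
Proof.
move=> mA; rewrite /pred_mean /predictive integral_indic// setIT.
by under eq_bigr do rewrite kint_indic//.
Qed.

(** For positive [n] this is the defining property of the conditional probability. For [n = 0] the
    formula reduces to [nu A] and [X_init] gives the claim, so that later arguments treat all [n]
    alike. *)
Lemma integral_predictive_past n A E : measurable A -> <<s past_events n >> E ->
  \int[P]_(w in E) (\1_A (X n w))%:E =
  \int[P]_(w in E) pred_mean n (fun x => (\1_A x)%:E) w.
Proof.
move=> mA FE.
have mE : measurable E.
  move: FE; apply: smallest_sub; first exact: sigma_algebra_measurable.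
  exact: past_events_measurable.
have mXA : measurable (X n @^-1` A).
  by rewrite -[X in measurable X]setTI; exact: measurable_funP.
rewrite (_ : (fun w => (\1_A (X n w))%:E) = fun w => (\1_(X n @^-1` A) w)%:E)//.
rewrite integral_indic//.
have [mpred pred_ge0] := posop_nnm (posop_pred_mean n) (nnm_indic mA).
case: n mXA mpred pred_ge0 FE => [|n] mXA mpred pred_ge0 FE.
  have pred0 w : pred_mean 0 (fun x => (\1_A x)%:E) w = nu A.
    rewrite pred_mean_indic// /predictive big_ord0 adde0 add0r.
    by rewrite muleAC -EFinM divff ?mul1e// gt_eqF.
  under eq_integral do rewrite pred0.
  rewrite integral_cst// -X_init// /distribution /pushforward.
  (* there are no past variables, so the sigma-field is trivial *)
  have [->|->] : E = set0 \/ E = setT.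
    move: FE; rewrite /past_events big_ord0.
    apply: (@smallest_sub _ _ _ [set E | E = set0 \/ E = setT]) => //.
    split=> [|B|B B01]; first by left.
      by case=> ->; rewrite setTD ?setC0 ?setCT; [right|left].
    have [[n Bn]|BN] := pselect (exists n, B n = setT).
      by right; apply/seteqP; split=> // w _; exists n => //; rewrite Bn.
    left; apply/seteqP; split=> // w [n _]; have [->//|Bn] := B01 n.
    by case: BN; exists n.
  by rewrite setI0 !measure0 mule0.
  rewrite setIT [X in _ * X](_ : _ = 1) ?mule1//.
  exact: probability_setT.
have [Z [mZ PZ] ZE] := X_pred (isT : (1 <= n.+1)%N) mA.
apply: (eq_trans (esym (PZ _ FE))); apply: ae_eq_integral => //.
- apply: measurable_funTS => _ B mB; rewrite setTI.
  have := mZ _ mB; apply: smallest_sub; first exact: sigma_algebra_measurable.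
  exact: past_events_measurable.
- exact: measurable_funTS.
- by apply: filterS ZE => w -> _; rewrite pred_mean_indic.
Qed.

(** The predictive rule integrated against an adapted weight, with the normalising constant cleared
    from the right-hand side. *)
Lemma predictive_step n V h : adapted n V -> nnm h ->
  (\int[P]_w (V w * h (X n w))) * (n%:R + theta)%:E =
  theta%:E * (\int[nu]_x h x) * (\int[P]_w V w)
  + \sum_(i < n) \int[P]_w (V w * kint K h (X i w)).
Proof.
move=> aV nh; have nV := adapted_nnm aV.
have [mV V0] := nV.
have n0 : (0 < n%:R + theta)%R by rewrite ltr_wpDl.
(* [posop_ext] reduces [h] to an indicator; [integral_mul_sub_sigma] then reduces [V] to events of
   the past, where the rule is known. *)
have -> : \int[P]_w (V w * h (X n w)) = \int[P]_w (V w * pred_mean n h w).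
  pose L h (_ : unit) := \int[P]_w (V w * (h \o X n) w).
  pose M h (_ : unit) := \int[P]_w (V w * pred_mean n h w).
  have pI := posop_comp (posop_integral (T2 := unit) P) (posop_mul nV).
  have pL : posop L by apply: (posop_comp pI); exact: posop_precomp.
  have pM : posop M by exact: (posop_comp pI (posop_pred_mean n)).
  have := posop_ext pL pM.
  move=> /(_ _ h nh) /(congr1 (fun g => g tt)); apply=> A [] mA.
  rewrite /L /M.
  apply: (integral_mul_sub_sigma (@past_events_measurable n)) => //.
  - exact: nnm_comp (nnm_indic mA).
  - by apply: (posop_nnm (posop_pred_mean n)); exact: nnm_indic.
  - by move=> E FE; exact: integral_predictive_past.
have [mh h0] := nh; have nk := nnm_kint K nh.
have nkX i : nnm (fun w => kint K h (X i w)) by exact: nnm_comp.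
have ih0 : 0 <= \int[nu]_x h x by exact: integral_ge0.
have th0 : 0 <= theta%:E :> \bar R by rewrite lee_fin ltW.
have [mp p0] := posop_nnm (posop_pred_mean n) nh.
rewrite -ge0_integralZr//; last 3 first.
- exact: emeasurable_funM.
- by move=> w _; exact: mule_ge0.
- by rewrite lee_fin ltW.
rewrite -ge0_integralZl//; last exact: mule_ge0.
rewrite -ge0_integral_sum//; last 2 first.
- by move=> i; case: (nnmM nV (nkX i)).
- by move=> i w _; case: (nnmM nV (nkX i)).
rewrite -ge0_integralD//; last 4 first.
- by move=> w _; rewrite !mule_ge0.
- exact: emeasurable_funM.
- by move=> w _; case: (nnm_sum (index_enum 'I_n) (fun i => nnmM nV (nkX i))).
- by case: (nnm_sum (index_enum 'I_n) (fun i => nnmM nV (nkX i))).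
apply: eq_integral => w _; rewrite /pred_mean -!muleA -EFinM mulVf ?gt_eqF// mule1.
rewrite ge0_muleDr; last 2 first.
- exact: mule_ge0.
- by apply: sume_ge0 => i _; case: (nkX i).
rewrite ge0_sume_distrr; last by move=> i _; case: (nkX i).
by congr (_ + _); rewrite [RHS]muleA muleC.
Qed.

(** * Decomposition of two consecutive predictive steps *)

Definition kernel_sum (n : nat) (V : Omega -> \bar R) (h : S -> \bar R) : \bar R :=
  \sum_(i < n) \int[P]_w (V w * kint K h (X i w)).

Definition kernel_sum2 (n : nat) (V : Omega -> \bar R) (g h : S -> \bar R) : \bar R :=
  \sum_(i < n) kernel_sum n (fun w => V w * kint K h (X i w)) g.

(** This is the expanded expectation of [V] times the product of the unnormalised predictive means
    of [g] and [h], both given the first [n] variables. *)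
Definition sym_part (n : nat) (V : Omega -> \bar R) (g h : S -> \bar R) : \bar R :=
  theta%:E * (\int[nu]_x h x) * (theta%:E * (\int[nu]_x g x) * \int[P]_w V w)
  + (theta%:E * (\int[nu]_x h x) * kernel_sum n V g
     + theta%:E * (\int[nu]_x g x) * kernel_sum n V h)
  + kernel_sum2 n V g h.

(* Its symmetry in (g, h) decides whether the variables n and n+1 may be swapped. *)
Definition asym_part (n : nat) (V : Omega -> \bar R) (g h : S -> \bar R) : \bar R :=
  theta%:E * (\int[nu]_x (g x * kint K h x)) * (\int[P]_w V w)
  + kernel_sum n V (fun x => g x * kint K h x).

Lemma kernel_sum2C n V g h : kernel_sum2 n V g h = kernel_sum2 n V h g.
Proof.
rewrite /kernel_sum2 /kernel_sum.
apply: (eq_trans (exchange_big _ _ _ _ _ _)).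
apply: eq_bigr => i _; apply: eq_bigr => j _.
by apply: eq_integral => w _; exact: muleAC.
Qed.

Lemma sym_partC n V g h : sym_part n V g h = sym_part n V h g.
Proof.
rewrite /sym_part kernel_sum2C.
move: (theta%:E * (\int[nu]_x g x)) (theta%:E * (\int[nu]_x h x)) => a b.
by rewrite (muleCA b a) (addeC (b * kernel_sum n V g) (a * kernel_sum n V h)).
Qed.

Lemma kernel_sum_ge0 n V h : nnm V -> nnm h -> 0 <= kernel_sum n V h.
Proof.
move=> [_ V0] nh; apply: sume_ge0 => i _; apply: integral_ge0 => w _.
by rewrite mule_ge0//; case: (nnm_kint K nh).
Qed.

Lemma sym_part_ge0 n V g h : nnm V -> nnm g -> nnm h -> 0 <= sym_part n V g h.
Proof.
move=> nV ng nh; have [_ V0] := nV.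
have t_ge0 f : nnm f -> 0 <= theta%:E * \int[nu]_x f x.
  move=> [_ f0]; apply: mule_ge0; first by rewrite lee_fin ltW.
  exact: integral_ge0.
have k_ge0 f : nnm f -> 0 <= kernel_sum n V f by exact: kernel_sum_ge0.
apply: adde_ge0.
  apply: adde_ge0; last by apply: adde_ge0; apply: mule_ge0; auto.
  apply: mule_ge0; first exact: t_ge0.
  by apply: mule_ge0; [exact: t_ge0|exact: integral_ge0].
apply: sume_ge0 => i _; apply: kernel_sum_ge0 => //.
by apply: nnmM => //; apply: nnm_comp => //; exact: nnm_kint.
Qed.

Lemma asym_part_ge0 n V g h : nnm V -> nnm g -> nnm h -> 0 <= asym_part n V g h.
Proof.
move=> nV ng nh; have ngh := nnmM ng (nnm_kint K nh).
apply: adde_ge0; last exact: kernel_sum_ge0.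
apply: mule_ge0; last by apply: integral_ge0 => w _; case: nV.
by apply: mule_ge0; [rewrite lee_fin ltW|apply: integral_ge0 => x _; case: ngh].
Qed.

(** The rule for [X n.+1] is applied with weight [V * g (X n)], then the rule for [X n] in each
    resulting term. The [nu] term and the terms with [i < n] add up to [sym_part]. *)
Lemma two_step n V g h : adapted n V -> nnm g -> nnm h ->
  (\int[P]_w (V w * g (X n w) * h (X n.+1 w)))
    * (n.+1%:R + theta)%:E * (n%:R + theta)%:E =
  sym_part n V g h + asym_part n V g h.
Proof.
move=> aV ng nh; have nV := adapted_nnm aV; have [_ V0] := nV.
have nkg := nnm_kint K ng; have nkh := nnm_kint K nh.
have ngkh := nnmM ng nkh.
have th0 : 0 <= theta%:E :> \bar R by rewrite lee_fin ltW.
have ig0 : 0 <= \int[nu]_x g x by apply: integral_ge0 => x _; case: ng.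
have ih0 : 0 <= \int[nu]_x h x by apply: integral_ge0 => x _; case: nh.
have tg0 := mule_ge0 th0 ig0; have th'0 := mule_ge0 th0 ih0.
have eV0 : 0 <= \int[P]_w V w by exact: integral_ge0.
have kg0 := kernel_sum_ge0 n nV ng; have kh0 := kernel_sum_ge0 n nV nh.
have nVh (i : 'I_n) : adapted n (fun w => V w * kint K h (X i w)).
  by apply: adaptedM => //; exact: adapted_X.
have aVg : adapted n.+1 (fun w => V w * g (X n w)).
  by apply: adaptedM; [exact: adapted_le aV|exact: adapted_X].
have n0 : 0 <= (n%:R + theta)%:E :> \bar R by rewrite lee_fin addr_ge0// ltW.
have [_ Vg0] := adapted_nnm aVg.
pose J i := \int[P]_w (V w * g (X n w) * kint K h (X i w)).
have J0 i : 0 <= J i.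
  by apply: integral_ge0 => w _; rewrite mule_ge0//; case: nkh.
rewrite predictive_step// (big_ord_recr _ (fun i => J i)) sume_distr4//; last first.
  exact: integral_ge0.
rewrite predictive_step// -/(kernel_sum n V g).
(* In the term of index [n], both [g] and [kint K h] are evaluated at [X n]; this term alone
   produces [asym_part]. *)
have JnE : J n = \int[P]_w (V w * (g (X n w) * kint K h (X n w))).
  by apply: eq_integral => w _; rewrite muleA.
rewrite JnE (predictive_step aV ngkh) -/(kernel_sum n V _) -/(asym_part n V g h).
have JE (i : 'I_n) : J i * (n%:R + theta)%:E =
    theta%:E * (\int[nu]_x g x) * (\int[P]_w (V w * kint K h (X i w))) +
    kernel_sum n (fun w => V w * kint K h (X i w)) g.
  rewrite /kernel_sum -(predictive_step (nVh i) ng); congr (_ * _).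
  by apply: eq_integral => w _; rewrite muleAC.
rewrite (eq_bigr _ (fun i _ => JE i)) big_split/= -/(kernel_sum2 n V g h) /sym_part.
rewrite -ge0_sume_distrr; last first.
  by move=> i _; apply: integral_ge0 => w _; case: (adapted_nnm (nVh i)).
rewrite (ge0_muleDr _ (mule_ge0 tg0 eV0) kg0) -/(kernel_sum n V h).
by rewrite !addeA.
Qed.

Lemma addn_theta_gt0 n : (0 < n%:R + theta)%R.
Proof. by rewrite ltr_wpDl. Qed.

Lemma two_step_swap n V g h : adapted n V -> nnm g -> nnm h ->
  asym_part n V g h = asym_part n V h g ->
  \int[P]_w (V w * g (X n w) * h (X n.+1 w)) =
  \int[P]_w (V w * h (X n w) * g (X n.+1 w)).
Proof.
move=> aV ng nh asymC.
apply: (mule_cancel (addn_theta_gt0 n.+1)); apply: (mule_cancel (addn_theta_gt0 n)).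
apply: (eq_trans (two_step aV ng nh)); apply/esym.
by apply: (eq_trans (two_step aV nh ng)); rewrite asymC (sym_partC n V h g).
Qed.

(** The two decompositions share [sym_part]. Cancelling it requires it to be finite, which follows
    from the bound on the integral. *)
Lemma asym_part_swap n V g h : adapted n V -> nnm g -> nnm h ->
  \int[P]_w (V w * g (X n w) * h (X n.+1 w)) =
  \int[P]_w (V w * h (X n w) * g (X n.+1 w)) ->
  \int[P]_w (V w * g (X n w) * h (X n.+1 w)) < +oo ->
  asym_part n V g h = asym_part n V h g.
Proof.
move=> aV ng nh IC Ioo; have nV := adapted_nnm aV.
have I0 : 0 <= \int[P]_w (V w * g (X n w) * h (X n.+1 w)).
  by apply: integral_ge0 => w _; rewrite !mule_ge0//;
    [case: nV|case: ng|case: nh].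
have Ifin : sym_part n V g h + asym_part n V g h < +oo.
  have Ifin : \int[P]_w (V w * g (X n w) * h (X n.+1 w)) \is a fin_num.
    by rewrite ge0_fin_numE.
  by rewrite -(two_step aV ng nh) !lte_mul_pinfty ?fin_numM ?ltry// mule_ge0//
    lee_fin ltW// addn_theta_gt0.
apply: (@adde_cancel _ (sym_part n V g h)); first exact: sym_part_ge0.
  by apply: le_lt_trans Ifin; apply: leeDl; exact: asym_part_ge0.
have := two_step aV nh ng; rewrite -IC (sym_partC n V h g).
exact: eq_trans (esym (two_step aV ng nh)).
Qed.

(** * Invariance under permutations *)

(** The test functions are indexed by all naturals, so that a permutation acts by composition and
    [n] can vary without casts. *)
Definition joint (n : nat) (f : nat -> S -> \bar R) : \bar R :=
  \int[P]_w \prod_(i < n) f i (X i w).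

Lemma adapted_prod n m (f : nat -> S -> \bar R) : (m <= n)%N -> (forall i, nnm (f i)) ->
  adapted n (fun w => \prod_(i < m) f i (X i w)).
Proof.
move=> mn nf; apply: nnm_prod => i; apply: adapted_X => //.
exact: leq_trans mn.
Qed.

Lemma joint2E n f : joint n.+2 f =
  \int[P]_w (\prod_(i < n) f i (X i w) * f n (X n w) * f n.+1 (X n.+1 w)).
Proof. by apply: eq_integral => w _; rewrite !big_ord_recr. Qed.

Definition swapn (a b k : nat) : nat :=
  if k == a then b else if k == b then a else k.

Lemma swapnK a b : involutive (swapn a b).
Proof.
move=> k; rewrite /swapn; have [->|ka] := eqVneq k a.
  by have [->|] := eqVneq b a => //; rewrite eqxx.
have [->|kb] := eqVneq k b; first by rewrite eqxx.
by rewrite (negPf ka) (negPf kb).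
Qed.

(** By finiteness such a map permutes the first [n] indices. Plain maps on the naturals suit an
    induction on [n] better than elements of [{perm 'I_n}]. *)
Definition perm_below (n : nat) (s : nat -> nat) : Prop :=
  injective s /\ forall i, (i < n)%N -> (s i < n)%N.

Lemma perm_below_swapn n a b : (a < n)%N -> (b < n)%N -> perm_below n (swapn a b).
Proof.
move=> an bn; split=> [|i]; first exact: inv_inj (swapnK a b).
by rewrite /swapn; case: ifP => // _; case: ifP.
Qed.

Lemma perm_below_comp n s t : perm_below n s -> perm_below n t ->
  perm_below n (s \o t).
Proof.
move=> [si sn] [ti tn]; split=> [|i /tn/sn//]; exact: inj_comp.
Qed.

Definition symmetric_law (n : nat) : Prop :=
  forall s f, perm_below n s -> (forall i, nnm (f i)) ->
    joint n (f \o s) = joint n f.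

(* Absorbs a factor h (X k) into the k-th function, so that the sum in the predictive
   rule is again expressed with joint. *)
Definition weight (f : nat -> S -> \bar R) (k : nat) (h : S -> \bar R) (i : nat)
  (x : S) : \bar R := f i x * (if i == k then h x else 1).

Lemma nnm_weight f k h i : (forall i, nnm (f i)) -> nnm h -> nnm (weight f k h i).
Proof.
move=> nf nh; apply: nnmM => //; case: (i == k) => //; exact: nnm_cst.
Qed.

(** By injectivity [s i = s k] only for [i = k], so exactly one factor carries the weight. *)
Lemma prod_weight n (s : nat -> nat) f (k : 'I_n) h w : injective s ->
  \prod_(i < n) weight f (s k) h (s i) (X i w) =
  \prod_(i < n) f (s i) (X i w) * h (X k w).
Proof.
move=> si; rewrite big_split/=; congr (_ * _).
rewrite (bigD1 k)//= eqxx big1 ?mule1// => i ik.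
by rewrite (inj_eq si) ifF//; apply/negbTE.
Qed.

Lemma joint_step n f : (forall i, nnm (f i)) ->
  joint n.+1 f * (n%:R + theta)%:E =
  theta%:E * (\int[nu]_x f n x) * joint n f
  + \sum_(i < n) joint n (weight f i (kint K (f n))).
Proof.
move=> nf; rewrite /joint; under eq_integral do rewrite big_ord_recr/=.
rewrite (predictive_step (adapted_prod (leqnn n) nf) (nf n)); congr (_ + _).
apply: eq_bigr => i _; apply: eq_integral => w _.
exact/esym/(@prod_weight n id _ _ _ _ (@inj_id nat)).
Qed.

(** By [joint_step] both sides are sums of expectations over the first [n] variables with the same
    last function. These are invariant by hypothesis, once the sum over the kernel terms is
    reindexed by [s]. *)
Lemma joint_fix_last n s f : symmetric_law n -> perm_below n.+1 s -> s n = n ->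
  (forall i, nnm (f i)) -> joint n.+1 (f \o s) = joint n.+1 f.
Proof.
move=> symn [si sn] snn nf.
(* By injectivity no [i < n] is sent to [n], since [n] is already the image of itself. *)
have sb : perm_below n s.
  split=> // i i_n; have := sn i (ltnW i_n); rewrite ltnS leq_eqVlt => /orP[|//].
  by rewrite -{1}snn (inj_eq si) ltn_eqF.
apply: (mule_cancel (addn_theta_gt0 n)).
apply: (eq_trans (@joint_step n (f \o s) (fun i => nf (s i)))).
apply/esym/(eq_trans (joint_step n nf)).
rewrite -(symn s f sb nf) /= snn; congr (_ + _).
pose so (i : 'I_n) := Ordinal (sb.2 i (ltn_ord i)).
have so_inj : injective so by move=> i j /(congr1 val)/= /si/val_inj.
rewrite (reindex_inj so_inj)/=; apply: eq_bigr => i _.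
have nw j : nnm (weight f (s i) (kint K (f n)) j).
  by apply: nnm_weight => //; exact: nnm_kint.
rewrite -(symn s _ sb nw); apply: eq_integral => w _ /=.
by rewrite (prod_weight f i _ w si) (prod_weight (f \o s) i _ w (@inj_id nat)).
Qed.

(** Swapping 0 and [i] carries the law of [X 0] to [X i]; the test functions are an indicator at one
    position and 1 elsewhere. *)
Lemma symmetric_law_marginal n i (A : set S) : symmetric_law n -> (i < n)%N ->
  measurable A -> P (X i @^-1` A) = nu A.
Proof.
move=> symn i_n mA.
have jE k : (k < n)%N -> joint n (fun j x => if j == k then (\1_A x)%:E else 1) =
    P (X k @^-1` A).
  move=> kn; transitivity (\int[P]_w (\1_(X k @^-1` A) w)%:E).
    apply: eq_integral => w _; rewrite (bigD1 (Ordinal kn))//= eqxx big1 ?mule1//.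
    by move=> j jk; rewrite ifF//; apply/negbTE.
  rewrite integral_indic ?setIT// -[X in measurable X]setTI; exact: measurable_funP.
have n0 : (0 < n)%N by exact: leq_ltn_trans i_n.
rewrite -X_init// -jE// /distribution /pushforward -[RHS]jE//.
rewrite -[RHS](symn (swapn 0 i)); last 2 first.
- exact: perm_below_swapn.
- by move=> j; case: (j == 0%N); [exact: nnm_indic|exact: nnm_cst].
apply: eq_integral => w _; apply: eq_bigr => j _ /=.
congr (if _ then _ else _); rewrite -[X in _ = (_ == X)](_ : swapn 0 i i = 0%N).
  by rewrite (inj_eq (inv_inj (swapnK 0 i))).
by rewrite /swapn eqxx; case: eqP.
Qed.

(** * The reversibility conditions and the invariance they imply *)

Definition reversible_nu : Prop := forall A B : set S, measurable A -> measurable B ->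
  \int[nu]_(y in A) (K y : probability S R) B =
  \int[nu]_(y in B) (K y : probability S R) A.

Definition reversible_K : Prop := forall A B : set S, measurable A -> measurable B ->
  {ae nu, forall x,
    \int[K x : probability S R]_(y in A) (K y : probability S R) B =
    \int[K x : probability S R]_(y in B) (K y : probability S R) A}.

Lemma reversible_nu_fun g h : reversible_nu -> nnm g -> nnm h ->
  \int[nu]_x (g x * kint K h x) = \int[nu]_x (h x * kint K g x).
Proof.
move=> rev; apply: (reversible_ext (posop_integral nu)) => A B mA mB.
by rewrite !integral_mul_indic//; exact: rev.
Qed.

Lemma ae_preimage i (Q : set S) : (forall A, measurable A -> P (X i @^-1` A) = nu A) ->
  {ae nu, forall x, Q x} -> {ae P, forall w, Q (X i w)}.
Proof.
move=> XE [N [mN N0 QN]]; exists (X i @^-1` N); split.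
- by rewrite -[X in measurable X]setTI; exact: measurable_funP.
- by apply: (eq_trans (XE _ mN)).
- by move=> w /= QX; exact: QN.
Qed.

(** The second condition holds only for [nu]-almost all points. As [X i] has law [nu], it holds at
    [X i] almost surely, and [reversible_ext] passes from sets to functions. *)
Lemma kernel_sum_rev n V g h : reversible_K ->
  (forall i A, (i < n)%N -> measurable A -> P (X i @^-1` A) = nu A) ->
  nnm V -> nnm g -> nnm h ->
  kernel_sum n V (fun x => g x * kint K h x) =
  kernel_sum n V (fun x => h x * kint K g x).
Proof.
move=> rev XE nV ng nh; apply: eq_bigr => i _.
have mXi : measurable_fun setT (X i) by [].
pose L f (_ : unit) := \int[P]_w (V w * kint K f (X i w)).
have pL : posop L.
  apply: (posop_comp (posop_integral P)); apply: (posop_comp (posop_mul nV)).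
  exact: (posop_comp (posop_precomp mXi) (posop_kint K)).
suff LAB A B : measurable A -> measurable B ->
    L (fun x => (\1_A x)%:E * (K x : probability S R) B) tt =
    L (fun x => (\1_B x)%:E * (K x : probability S R) A) tt.
  exact: (reversible_ext pL LAB ng nh).
move=> mA mB; rewrite /L.
have nAB C D : measurable C -> measurable D ->
    nnm (fun w => V w * kint K (fun x => (\1_C x)%:E * (K x : probability S R) D) (X i w)).
  move=> mC mD; apply: nnmM => //; apply: (nnm_comp mXi); apply: nnm_kint.
  apply: nnmM; first exact: nnm_indic.
  by split; [exact: measurable_kernel_eval|].
have [mAB AB0] := nAB _ _ mA mB; have [mBA BA0] := nAB _ _ mB mA.
apply: ge0_ae_eq_integral => //.
have := ae_preimage (fun A => XE i A (ltn_ord i)) (rev A B mA mB).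
apply: filterS => w revw _; congr (_ * _).
by rewrite /kint !integral_mul_indic.
Qed.

Lemma joint_swapE n f : joint n.+2 (f \o swapn n n.+1) =
  \int[P]_w (\prod_(i < n) f i (X i w) * f n.+1 (X n w) * f n (X n.+1 w)).
Proof.
rewrite joint2E /= /swapn !eqxx (_ : n.+1 == n = false) ?gtn_eqF//.
apply: eq_integral => w _; congr (_ * _ * _); apply: eq_bigr => i _ /=.
by rewrite !ifF// ltn_eqF// ltnS ltnW.
Qed.

Lemma joint_swap n f : reversible_nu -> reversible_K -> symmetric_law n.+1 ->
  (forall i, nnm (f i)) -> joint n.+2 (f \o swapn n n.+1) = joint n.+2 f.
Proof.
move=> rev1 rev2 symn nf; rewrite joint_swapE joint2E.
have aV := adapted_prod (leqnn n) nf.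
apply: (two_step_swap aV (nf n.+1) (nf n)); rewrite /asym_part.
rewrite (reversible_nu_fun rev1 (nf n.+1) (nf n)).
rewrite (kernel_sum_rev rev2 _ (adapted_nnm aV) (nf n.+1) (nf n))//.
by move=> i A i_n mA; apply: symmetric_law_marginal symn _ mA; exact: ltnW.
Qed.

Lemma reversible_symmetric_law n : reversible_nu -> reversible_K -> symmetric_law n.
Proof.
move=> rev1 rev2; elim: n => [|n IHn] s f sb nf.
  by apply: eq_integral => w _; rewrite !big_ord0.
have [snn|snn] := eqVneq (s n) n; first exact: joint_fix_last.
have sn : (s n < n)%N by rewrite ltn_neqAle snn -ltnS sb.2.
case: n => [//|m] in IHn sb snn sn *.
(* When [s] moves the last index, it is the composite of [r], [t] and [t \o (r \o s)]. The first and
   the third fix [m.+1], since [r] sends [s m.+1] to [m] and [t] sends [m] to [m.+1]; the middle one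
   is the swap of the last two indices. *)
pose r := swapn (s m.+1) m; pose t := swapn m m.+1.
have rb : perm_below m.+2 r by apply: perm_below_swapn => //; exact: ltnW.
have tb : perm_below m.+2 t by exact: perm_below_swapn.
have frs : f \o s = ((f \o r) \o t) \o (t \o (r \o s)).
  by apply/funext => i /=; rewrite /t /r !swapnK.
have nfr i : nnm ((f \o r) i) by exact: nf.
have rn : r m.+1 = m.+1 by rewrite /r /swapn (gtn_eqF sn) gtn_eqF.
have tbs := perm_below_comp tb (perm_below_comp rb sb).
have tn : (t \o (r \o s)) m.+1 = m.+1 by rewrite /= /r /t {2}/swapn eqxx /swapn eqxx.
rewrite frs (joint_fix_last IHn tbs tn); last by move=> i; exact: nf.
rewrite (joint_swap rev1 rev2 IHn nfr); exact: joint_fix_last IHn rb rn nf.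
Qed.

(** * From rectangles to measurable sets *)

Definition rectangle (n : nat) (A : nat -> set S) : set (n.-tuple S) :=
  [set t | forall i : 'I_n, A i (tnth t i)].

Arguments rectangle : clear implicits.

Lemma measurable_rectangle n A : (forall i, measurable (A i)) ->
  measurable (rectangle n A).
Proof.
move=> mA; rewrite (_ : rectangle n A =
    \bigcap_(i in [set: 'I_n]) (@tnth n S ^~ i) @^-1` A i); last first.
  by apply/seteqP; split=> [t tA i _|t tA i]; exact: tA.
apply: fin_bigcap_measurable => // i _.
by rewrite -[X in measurable X]setTI; exact: measurable_tnth.
Qed.

Lemma measurable_joint_event n A : (forall i, measurable (A i)) ->
  measurable [set w | forall i : 'I_n, A i (X i w)].
Proof.
move=> mA; rewrite (_ : mkset _ = \bigcap_(i in [set: 'I_n]) X i @^-1` A i).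
  apply: fin_bigcap_measurable => // i _.
  by rewrite -[X in measurable X]setTI; exact: measurable_funP.
by apply/seteqP; split=> [w wA i _|w wA i]; exact: wA.
Qed.

Lemma joint_indic n A : (forall i, measurable (A i)) ->
  joint n (fun i x => (\1_(A i) x)%:E) =
  P [set w | forall i : 'I_n, A i (X i w)].
Proof.
move=> mA; have mE := @measurable_joint_event n A mA; set E := [set w | _].
rewrite -[in RHS](setIT E) -integral_indic//.
apply: eq_integral => w _; have [wE|] := pselect (E w).
  by rewrite indicE mem_set// big1// => i _; rewrite indicE mem_set.
move=> wE; have := wE; move/existsNP => [i wi].
by rewrite indicE memNset// (bigD1 i)//= indicE memNset// mul0e.
Qed.

Definition perm_nat (n : nat) (s : {perm 'I_n}) (k : nat) : nat :=
  if insub k is Some i then s i else k.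

Lemma perm_natE n (s : {perm 'I_n}) (i : 'I_n) : perm_nat s i = s i.
Proof. by rewrite /perm_nat valK. Qed.

Lemma perm_below_perm_nat n (s : {perm 'I_n}) : perm_below n (perm_nat s).
Proof.
split=> [|i i_n]; last by rewrite (perm_natE s (Ordinal i_n)).
apply: (can_inj (g := perm_nat s^-1%g)) => k; rewrite {2}/perm_nat.
case: insubP => [i _ <-|kn]; first by rewrite perm_natE permK.
by rewrite /perm_nat insubF//; exact/negbTE.
Qed.

(** Requiring [X (s i)] to lie in [A i] for all [i] is requiring [X i] to lie in the set of index
    [s^-1 i], whence the inverse. *)
Lemma pushforward_rectangle n (s : {perm 'I_n}) A : (forall i, measurable (A i)) ->
  pushforward P (fun w => [tuple X (s i) w | i < n]) (rectangle n A) =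
  joint n ((fun i x => (\1_(A i) x)%:E) \o perm_nat s^-1%g).
Proof.
move=> mA; rewrite [RHS](@joint_indic n (A \o perm_nat s^-1%g)); last by move=> i; exact: mA.
rewrite /pushforward; congr (P _).
apply/seteqP; split=> w /= wA i.
  by have := wA (s^-1 i)%g; rewrite tnth_mktuple permKV perm_natE.
by have := wA (s i); rewrite perm_natE permK tnth_mktuple.
Qed.

Lemma pushforward_rectangle1 n A : (forall i, measurable (A i)) ->
  pushforward P (fun w => [tuple X i w | i < n]) (rectangle n A) =
  joint n (fun i x => (\1_(A i) x)%:E).
Proof.
move=> mA; rewrite joint_indic//; rewrite /pushforward; congr (P _).
by apply/seteqP; split=> w /= wA i; have := wA i; rewrite tnth_mktuple.
Qed.

Lemma exchangeable_joint n (s : {perm 'I_n}) A : exchangeable P X -> (2 <= n)%N ->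
  (forall i, measurable (A i)) ->
  joint n ((fun i x => (\1_(A i) x)%:E) \o perm_nat s) =
  joint n (fun i x => (\1_(A i) x)%:E).
Proof.
move=> exchX n2 mA; have mR := @measurable_rectangle n A mA.
have := exchX n n2 s^-1%g _ mR.
by rewrite pushforward_rectangle1// pushforward_rectangle// invgK.
Qed.

(** Rectangles are stable under intersection and generate the sigma-field on tuples, so Dynkin
    induction extends the equality of the two laws from rectangles to all measurable sets. *)
Lemma symmetric_law_exchangeable : (forall n, symmetric_law n) -> exchangeable P X.
Proof.
move=> symX n n2 s B mB.
pose G : set (set (n.-tuple S)) :=
  [set rectangle n A | A in [set A | forall i, measurable (A i)]].
have mtuple (e : 'I_n -> nat) :
    measurable_fun setT (fun w => [tuple X (e i) w | i < n]).
  apply/measurable_fun_tnthP => i.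
  rewrite (_ : _ \o _ = X (e i))//.
  by apply/funext => w /=; rewrite tnth_mktuple.
have mpre (e : 'I_n -> nat) C : measurable C ->
    measurable ((fun w => [tuple X (e i) w | i < n]) @^-1` C).
  by move=> mC; rewrite -[X in measurable X]setTI; exact: mtuple.
have GE : @measurable _ (n.-tuple S) = <<s G >>.
  apply/seteqP; split.
    apply: smallest_sub; first exact: smallest_sigma_algebra.
    elim/big_ind: _ => [//|C D Cm Dm|i _].
      by move=> E [/Cm|/Dm].
    move=> _ [C mC <-]; apply: sub_sigma_algebra.
    (* A cylinder over coordinate [i] is a rectangle whose other sides are the whole space. *)
    exists (fun j : nat => if j == i :> nat then C else setT) => /=.
      by move=> j; case: ifP.
    apply/seteqP; split=> t /=.
      by move=> /(_ i); rewrite eqxx; split.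
    by move=> [_ ti] j; case: eqP => // /val_inj ->.
  apply: smallest_sub; first exact: sigma_algebra_measurable.
  by move=> _ [A mA <-]; exact: measurable_rectangle.
have sGB : <<s G >> B by rewrite -GE.
pose Q C := pushforward P (fun w => [tuple X (s i) w | i < n]) C =
  pushforward P (fun w => [tuple X i w | i < n]) C.
move: sGB; apply: (@dynkin_induction _ _ G Q GE); rewrite /Q.
- move=> _ _ [A mA <-] [A' mA' <-]; exists (fun i => A i `&` A' i).
    by move=> i; exact: measurableI.
  apply/seteqP; split=> t /=; first by move=> tA; split=> i; have [] := tA i.
  by move=> [tA tA'] i; split.
- by rewrite /pushforward !preimage_setT.
- move=> _ [A mA <-]; rewrite pushforward_rectangle// pushforward_rectangle1//.
  apply: symX; first exact: perm_below_perm_nat.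
  by move=> i; exact: nnm_indic.
- move=> C mC PC.
  apply: (eq_trans (probability_setC P (mpre (fun i => s i) C mC))).
  apply/esym/(eq_trans (probability_setC P (mpre (fun i => i) C mC))).
  exact: (congr1 (fun p => 1 - p) (esym PC)).
- move=> F mF tF PF.
  have PU (e : 'I_n -> nat) :
      pushforward P (fun w => [tuple X (e i) w | i < n]) (\bigcup_k F k) =
      \sum_(k <oo) pushforward P (fun w => [tuple X (e i) w | i < n]) (F k).
    rewrite /pushforward preimage_bigcup measure_bigcup//=.
    - by apply: eq_eseriesl => k; rewrite in_setT.
    - by move=> k _; exact: mpre.
    - by move=> i j _ _ [w [wi wj]]; apply: (tF i j) => //; eexists; split;
        [exact: wi|exact: wj].
  apply: (eq_trans (PU (fun i => s i))); apply/esym/(eq_trans (PU (fun i => i))).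
  by apply: eq_eseriesr => k _; exact/esym/PF.
Qed.

(** * Reversibility *)

Lemma integral_init f : nnm f -> \int[P]_w f (X 0%N w) = \int[nu]_x f x.
Proof.
move=> nf; pose L g (_ : unit) := \int[P]_w (g \o X 0%N) w.
have mX0 : measurable_fun setT (X 0%N) by [].
have pL : posop L by exact: (posop_comp (posop_integral P) (posop_precomp mX0)).
have := posop_ext pL (posop_integral nu).
move=> /(_ _ f nf) /(congr1 (fun g => g tt)); apply=> A [] mA.
transitivity (P (X 0%N @^-1` A)).
  rewrite /L (_ : (fun x => _) = fun w => (\1_(X 0%N @^-1` A) w)%:E)//.
  rewrite integral_indic ?setIT// -[X in measurable X]setTI.
  exact: measurable_funP.
by apply: (eq_trans (X_init mA)); rewrite integral_indic// setIT.
Qed.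

(** Exchangeability is used for the transposition of [n] and [n.+1] only. With indicators the
    integral is a probability, hence finite as [asym_part_swap] demands. [V] is given by an equation
    so that short products can be used in simplified form. *)
Lemma exchangeable_asym_part n (A : nat -> set S) (V : Omega -> \bar R) :
  exchangeable P X -> (forall i, measurable (A i)) ->
  V = (fun w => \prod_(i < n) (\1_(A i) (X i w))%:E) ->
  asym_part n V (fun x => (\1_(A n) x)%:E) (fun x => (\1_(A n.+1) x)%:E) =
  asym_part n V (fun x => (\1_(A n.+1) x)%:E) (fun x => (\1_(A n) x)%:E).
Proof.
move=> exchX mA VE; pose f i x := (\1_(A i) x)%:E : \bar R.
have nf i : nnm (f i) by exact: nnm_indic.
have aV : adapted n V by rewrite VE; exact: (@adapted_prod n n f).
have fE : joint n.+2 f = \int[P]_w (V w * f n (X n w) * f n.+1 (X n.+1 w)).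
  by rewrite VE; exact: joint2E.
apply: (asym_part_swap aV (nf n) (nf n.+1)); rewrite -fE; last first.
  rewrite joint_indic//.
  apply: (@le_lt_trans _ _ 1); last exact: ltry.
  exact: (probability_le1 P (@measurable_joint_event n.+2 A mA)).
rewrite VE -[RHS](joint_swapE n f).
pose i0 : 'I_n.+2 := inord n; pose i1 : 'I_n.+2 := ord_max.
rewrite -(exchangeable_joint (tperm i0 i1) exchX)//.
apply: eq_integral => w _; apply: eq_bigr => j _ /=.
congr (\1_(A _) _)%:E; rewrite perm_natE /swapn.
have i0E : i0 = n :> nat by rewrite inordK.
case: tpermP => [->|->|ji0 ji1]; rewrite ?i0E ?eqxx//.
  by rewrite gtn_eqF.
rewrite ifF; last by apply/eqP => jn; apply/ji0/val_inj; rewrite /= i0E.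
by rewrite ifF//; apply/eqP => jn; apply/ji1/val_inj.
Qed.

(** With [n = 0] and [V = 1] the kernel sum is empty, and [asym_part] is [theta] times the integral
    to be shown symmetric. *)
Lemma exchangeable_reversible_nu : exchangeable P X -> reversible_nu.
Proof.
move=> exchX A B mA mB.
pose F i := if i == 0%N then A else B.
have mF i : measurable (F i) by rewrite /F; case: ifP.
have asymE g h : asym_part 0 (fun=> 1) g h =
    (\int[nu]_x (g x * kint K h x)) * theta%:E.
  rewrite /asym_part /kernel_sum big_ord0 adde0.
  rewrite [X in _ * X](_ : _ = 1) ?mule1 1?muleC//.
  by rewrite integral_cst// mul1e; exact: probability_setT.
have V1 : (fun=> 1) = (fun w => \prod_(i < 0) (\1_(F i) (X i w))%:E) :> (Omega -> \bar R).
  by apply/funext => w; rewrite big_ord0.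
have := exchangeable_asym_part exchX mF V1.
rewrite !asymE => /(mule_cancel theta_gt0); rewrite /F /= !integral_mul_indic//.
under eq_integral do rewrite kint_indic//.
by under [in RHS]eq_integral do rewrite kint_indic//.
Qed.

Lemma kint_set A B x : measurable A -> measurable B ->
  \int[K x : probability S R]_(y in A) (K y : probability S R) B =
  kint K (fun y => (\1_A y)%:E * kint K (fun z => (\1_B z)%:E) y) x.
Proof.
move=> mA mB; rewrite /kint integral_mul_indic//.
by apply: eq_integral => y _; apply/esym; exact: kint_indic.
Qed.

Lemma nnm_kint_set A B : measurable A -> measurable B ->
  nnm (fun x => \int[K x : probability S R]_(y in A) (K y : probability S R) B).
Proof.
move=> mA mB; under eq_fun do rewrite kint_set//.
apply: nnm_kint; apply: nnmM; first exact: nnm_indic.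
exact/nnm_kint/nnm_indic.
Qed.

Lemma kint_set_le1 A B x : measurable A -> measurable B ->
  \int[K x : probability S R]_(y in A) (K y : probability S R) B <= 1.
Proof.
move=> mA mB; rewrite -(integral_mul_indic _ _ mA).
apply: integral_le1 => [|y].
  by apply: nnmM; [exact: nnm_indic|split; [exact: measurable_kernel_eval|]].
by rewrite indicE; case: (y \in A); rewrite ?mul1e ?mul0e//; exact: probability_le1.
Qed.

(** Two integrable functions with equal integrals over every measurable set [C] agree almost
    everywhere; here integrability holds because the values are at most 1. *)
Lemma reversible_K_integral :
  (forall A B C, measurable A -> measurable B -> measurable C ->
    \int[nu]_(x in C) \int[K x : probability S R]_(y in A) (K y : probability S R) B =
    \int[nu]_(x in C) \int[K x : probability S R]_(y in B) (K y : probability S R) A) ->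
  reversible_K.
Proof.
move=> KC A B mA mB.
have [mAB AB0] := nnm_kint_set mA mB; have [mBA BA0] := nnm_kint_set mB mA.
have iAB : nu.-integrable setT
    (fun x => \int[K x : probability S R]_(y in A) (K y : probability S R) B).
  apply/integrableP; split=> //; under eq_integral do rewrite gee0_abs//.
  apply: (@le_lt_trans _ _ 1); last exact: ltry.
  by apply: integral_le1 => // x; exact: kint_set_le1.
have := integral_ae_eq measurableT iAB mBA (fun C _ mC => KC A B C mA mB mC).
by apply: filterS => x; exact.
Qed.

(** Take [n = 1] and for [V] the indicator of [C] at [X 0]. The first summand of [asym_part] is
    symmetric by the first condition and finite, so it cancels; the remaining equality of integrals
    over the arbitrary set [C] is what [reversible_K_integral] needs. *)
Lemma exchangeable_reversible_K : exchangeable P X -> reversible_K.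
Proof.
move=> exchX; apply: reversible_K_integral => A B C mA mB mC.
have revnu := exchangeable_reversible_nu exchX.
pose a x := (\1_A x)%:E : \bar R; pose b x := (\1_B x)%:E : \bar R.
have na : nnm a by exact: nnm_indic.
have nb : nnm b by exact: nnm_indic.
have nab : nnm (fun x => a x * kint K b x) by apply: nnmM => //; exact: nnm_kint.
have nba : nnm (fun x => b x * kint K a x) by apply: nnmM => //; exact: nnm_kint.
under eq_integral do rewrite kint_set//.
under [in RHS]eq_integral do rewrite kint_set//.
rewrite -/a -/b.
pose F i := if i == 0%N then C else if i == 1%N then A else B.
have mF i : measurable (F i) by rewrite /F; case: ifP => // _; case: ifP.
pose V w := (\1_C (X 0%N w))%:E : \bar R.
have nV : nnm V.
  by apply: (@nnm_comp _ _ _ _ _ (fun x => (\1_C x)%:E)) => //; exact: nnm_indic.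
have VE : V = (fun w => \prod_(i < 1) (\1_(F i) (X i w))%:E).
  by apply/funext => w; rewrite big_ord1.
have := exchangeable_asym_part exchX mF VE; rewrite /F /= -/a -/b.
rewrite /asym_part (reversible_nu_fun revnu na nb).
(* The only kernel term is at [X 0], which has law [nu]. *)
have step f : nnm f -> kernel_sum 1 V f = \int[nu]_(x in C) kint K f x.
  move=> nf; rewrite /kernel_sum big_ord1 /V.
  rewrite (@integral_init (fun x => (\1_C x)%:E * kint K f x)).
    exact: integral_mul_indic.
  by apply: nnmM; [exact: nnm_indic|exact: nnm_kint].
rewrite (step _ nab) (step _ nba).
have V1 : \int[P]_w V w <= 1.
  by apply: integral_le1 => // w; rewrite lee_fin indicE; case: (_ \in _).
have nba1 : \int[nu]_x (b x * kint K a x) <= 1.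
  apply: integral_le1 => // x; rewrite /a /b kint_indic// indicE.
  by case: (_ \in _); rewrite ?mul1e ?mul0e//; exact: probability_le1.
have V0 : 0 <= \int[P]_w V w by apply: integral_ge0 => w _; case: nV.
have nba0 : 0 <= \int[nu]_x (b x * kint K a x).
  by apply: integral_ge0 => x _; case: nba.
have fin (z : \bar R) : 0 <= z -> z <= 1 -> z \is a fin_num.
  by move=> z0 z1; rewrite ge0_fin_numE// (le_lt_trans z1)// ltry.
apply: adde_cancel; first by rewrite !mule_ge0// lee_fin ltW.
rewrite -ge0_fin_numE; last by rewrite !mule_ge0// lee_fin ltW.
by rewrite !fin_numM// fin.
Qed.

(** * Kernels that are regular conditional distributions *)

(** Here [kint K] is conditional expectation given [G]. Moving it between factors turns each side of
    both conditions into an integral of a product of values of [K], and such a product is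
    commutative. *)
Lemma regular_cond_distr_reversible (G : set (set S)) :
  sigma_algebra setT G -> G `<=` measurable -> regular_cond_distr nu G K ->
  reversible_nu /\ reversible_K.
Proof.
move=> sG Gm [KG condG].
have GE : <<s G >> = G by exact: smallest_id.
have mKG A : measurable A -> measurable_fun setT
    ((fun x => (K x : probability S R) A) : g_sigma_algebraType G -> \bar R).
  move=> mA _ B mB; rewrite setTI; have := KG A mA B mB.
  by rewrite -[X in X _ -> _]GE.
have kG f : nnm f -> nnm (kint K f : g_sigma_algebraType G -> \bar R).
  exact: (posop_nnm (@posop_kernel _ _ _ _ (g_sigma_algebraType G)
    (fun x => (K x : probability S R)) mKG)).
(* tower property: h may be replaced by its conditional expectation given G *)
have tower (f : g_sigma_algebraType G -> \bar R) h : nnm f -> nnm h ->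
    \int[nu]_x (f x * h x) = \int[nu]_x (f x * kint K h x).
  move=> nf nh; have nfS : nnm (f : S -> \bar R) by exact: nnm_sub_sigma nf.
  have pf := posop_comp (posop_integral (T2 := unit) nu) (posop_mul nfS).
  have := posop_ext pf (posop_comp pf (posop_kint K)).
  move=> /(_ _ h nh) /(congr1 (fun g => g tt)); apply=> A [] mA.
  apply: (integral_mul_sub_sigma Gm) => //.
  - exact: nnm_indic.
  - exact/nnm_kint/nnm_indic.
  - move=> E; rewrite GE => GE'; rewrite integral_indic; [|exact: Gm|exact: mA].
    apply: (eq_trans (condG A E mA GE')).
    by apply: eq_integral => x _; apply/esym; exact: kint_indic.
pose one (A : set S) x := (\1_A x)%:E : \bar R.
have n1 A : measurable A -> nnm (one A) by exact: nnm_indic.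
have kSG f : nnm f -> nnm (kint K f) by exact: nnm_kint.
have nuE A B : measurable A -> measurable B ->
    \int[nu]_(x in A) (K x : probability S R) B =
    \int[nu]_x (kint K (one B) x * kint K (one A) x).
  move=> mA mB; rewrite -tower; [|exact/kG/n1|exact: n1].
  rewrite (integral_mulindic _ _ mA); apply: eq_integral => x _.
  by congr (_ * _); apply/esym; exact: kint_indic.
split=> [A B mA mB|].
  rewrite (nuE A B mA mB) (nuE B A mB mA).
  by apply: eq_integral => x _; exact: muleC.
apply: reversible_K_integral => A B C mA mB mC.
(* both sides equal the nu-integral of K(C) K(B) K(A) *)
have KE A' B' : measurable A' -> measurable B' ->
    \int[nu]_(x in C) \int[K x : probability S R]_(y in A') (K y : probability S R) B' =
    \int[nu]_x (kint K (one C) x * kint K (one B') x * kint K (one A') x).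
  move=> mA' mB'.
  have nu1 : nnm (fun x => one A' x * kint K (one B') x).
    by apply: nnmM; [exact: n1|exact/kSG/n1].
  under eq_integral do rewrite kint_set//.
  rewrite (integral_mulindic _ _ mC).
  (* The tower property is used three times: the indicator of [C] becomes K(C), the outer [kint K]
     is then dropped against K(C), and the indicator of [A'] is matched with K(A'). Each time the
     other factor is [G]-measurable. *)
  rewrite (tower _ _ (kG _ nu1) (n1 _ mC)).
  under eq_integral do rewrite muleC.
  rewrite -(tower _ _ (kG _ (n1 _ mC)) nu1).
  rewrite -(tower _ _ (nnmM (kG _ (n1 _ mC)) (kG _ (n1 _ mB'))) (n1 _ mA')).
  by apply: eq_integral => x _; rewrite [one A' x * _]muleC muleA.
rewrite (KE A B mA mB) (KE B A mB mA).
by apply: eq_integral => x _; exact: muleAC.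
Qed.

(** * Equivalence of exchangeability and reversibility *)

Lemma exchangeable_iff_reversible : exchangeable P X <-> reversible_nu /\ reversible_K.
Proof.
split=> [exchX|[rev1 rev2]].
  by split; [exact: exchangeable_reversible_nu|exact: exchangeable_reversible_K].
by apply: symmetric_law_exchangeable => n; exact: reversible_symmetric_law.
Qed.

End Predictive.

Theorem theorem7 (R : realType)
    (T : topologicalType) (T_polish : polish R T)
    (S0 : set T) (S0_borel : borel S0) (S0_neq0 : S0 !=set0)
    (S := borel_subspace S0_neq0)
    (d : measure_display) (Omega : measurableType d) (P : probability Omega R)
    (nu : probability S R) (theta : R) (theta_gt0 : 0 < theta)
    (K : {mfun S >-> pprobability S R})
    (X : nat -> {RV P >-> S})
    (X_init : forall A : set S, measurable A -> distribution P (X 0%N) A = nu A)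
    (X_pred : forall n : nat, (1 <= n)%N -> forall A : set S, measurable A ->
       exists2 Z : Omega -> \bar R,
         is_cond_prob P (natural_filtration X n) (X n @^-1` A) Z &
         {ae P, forall w, Z w = predictive nu theta K X n A w}) :
  (exchangeable P X <->
     (forall A B : set S, measurable A -> measurable B ->
        (\int[nu]_(y in A) (K y : probability S R) B
         = \int[nu]_(y in B) (K y : probability S R) A)%E) /\
     (forall A B : set S, measurable A -> measurable B ->
        {ae nu, forall x,
          (\int[K x : probability S R]_(y in A) (K y : probability S R) B
           = \int[K x : probability S R]_(y in B) (K y : probability S R) A)%E}))
  /\
  ((exists G : set (set S),
      [/\ sigma_algebra setT G, G `<=` measurable &
          regular_cond_distr nu G K]) ->
   exchangeable P X).
Proof.
have exchP := exchangeable_iff_reversible theta_gt0 X_init X_pred.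
split=> // -[G [sG Gm KG]]; apply/exchP.
exact: regular_cond_distr_reversible sG Gm KG.
Qed.
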